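(* For every type $t$ of homogeneous regular expression of depth 2, given a homogeneous regular expression $\mathcal{A}$ of type $|+$ or of type $|*$ of size $m$ and a homogeneous regular expression $\mathcal{B}$ of type $t$ of size $n$, one can decide whether $\mathcal{L}(\mathcal{A})\cap\mathcal{L}(\mathcal{B})\neq\emptyset$ in $\mathcal{O}(m+n)$ time.
   Context: Regular expressions over an integer alphabet $\Sigma$ of size polynomial in the input size are built from letters with concatenation $\circ$, union $|$, Kleene plus $+$ and Kleene star $*$, and viewed as rooted trees with letters at leaves; the size is the number of leaves. A regexp is homogeneous of depth 2 and type $t_1t_2$, $t_1\ne t_2\in\{\circ,|,+,*\}$, if its root is labelled $t_1$, all depth-1 inner nodes are labelled $t_2$, their children are leaves, and the tree has depth 3 (children of the root may be leaves). A regexp of type $|+$ is a union $[T_1|\cdots|T_r]$ where each $T_j$ is a letter $c_j$ or $c_j^+$; one of type $|*$ is such a union where each $T_j$ is a letter $c_j$ or $c_j^*$. *)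

(* Defs.v *)
From HB Require Import structures.
From mathcomp Require Import all_boot.

Set Implicit Arguments.
Unset Strict Implicit.
Unset Printing Implicit Defensive.

(* Concatenation and union are n-ary; their children are given as a head and
   a tail, so every inner node has at least one child. *)
Inductive regexp :=
| Letter of nat
| Concat of regexp & seq regexp
| Union of regexp & seq regexp
| Plus of regexp
| Star of regexp.

Definition word := seq nat.
Definition language := word -> Prop.

Definition eps_lang : language := fun x => x = [::].
Definition empty_lang : language := fun _ => False.
Definition cat_lang (L1 L2 : language) : language :=
  fun x => exists u v, [/\ x = u ++ v, L1 u & L2 v].
Definition union_lang (L1 L2 : language) : language :=
  fun x => L1 x \/ L2 x.
Definition pow_lang (L : language) (k : nat) : language :=
  iter k (cat_lang L) eps_lang.

Fixpoint lang (e : regexp) : language :=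
  match e with
  | Letter c => fun x => x = [:: c]
  | Concat e1 es =>
      cat_lang (lang e1) (foldr (fun e' => cat_lang (lang e')) eps_lang es)
  | Union e1 es =>
      union_lang (lang e1) (foldr (fun e' => union_lang (lang e')) empty_lang es)
  | Plus e1 => fun x => exists2 k, 0 < k & pow_lang (lang e1) k x
  | Star e1 => fun x => exists k, pow_lang (lang e1) k x
  end.

Fixpoint nleaves (e : regexp) : nat :=
  match e with
  | Letter _ => 1
  | Concat e1 es | Union e1 es => nleaves e1 + sumn (map nleaves es)
  | Plus e1 | Star e1 => nleaves e1
  end.

Fixpoint over_alphabet (sigma : nat) (e : regexp) : bool :=
  match e with
  | Letter c => c < sigma
  | Concat e1 es | Union e1 es =>
      over_alphabet sigma e1 && all (over_alphabet sigma) es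
  | Plus e1 | Star e1 => over_alphabet sigma e1
  end.

Inductive op := OConcat | OUnion | OPlus | OStar.

Definition op_code (o : op) : nat :=
  match o with OConcat => 1 | OUnion => 2 | OPlus => 3 | OStar => 4 end.

Lemma op_code_inj : injective op_code.
Proof. by case=> [] []. Qed.

HB.instance Definition _ := Equality.copy op (inj_type op_code_inj).

Definition label (e : regexp) : option op :=
  match e with
  | Letter _ => None
  | Concat _ _ => Some OConcat
  | Union _ _ => Some OUnion
  | Plus _ => Some OPlus
  | Star _ => Some OStar
  end.

Definition children (e : regexp) : seq regexp :=
  match e with
  | Letter _ => [::]
  | Concat e1 es | Union e1 es => e1 :: es
  | Plus e1 | Star e1 => [:: e1]
  end.

Definition is_leaf (e : regexp) : bool := label e == None.

(* Type [t1 t2].  The tree has at most three levels; any child of the root,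
   and possibly every one of them, may be a leaf. *)
Definition homogeneous (t1 t2 : op) (e : regexp) : bool :=
  (label e == Some t1) &&
  all (fun d => is_leaf d || (label d == Some t2) && all is_leaf (children d))
      (children e).

Inductive arith := Add | Sub | Mul | Div | Mod.

Inductive instr :=
| Const of nat & nat
| Arith of arith & nat & nat & nat
| Read of nat & nat
| Write of nat & nat
| Jump of nat
| JumpEq of nat & nat & nat
| JumpLt of nat & nat & nat
| Halt of bool.

Definition program := seq instr.

Record state := State { pc : nat; reg : nat -> nat; mem : nat -> nat }.

Definition upd (f : nat -> nat) (i v : nat) : nat -> nat :=
  fun j => if j == i then v else f j.

(* Registers and memory cells hold w-bit words; arithmetic is modulo 2 ^ w. *)
Definition eval_arith (w : nat) (o : arith) (x y : nat) : nat :=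
  match o with
  | Add => x + y
  | Sub => x + 2 ^ w - y
  | Mul => x * y
  | Div => x %/ y
  | Mod => x %% y
  end %% 2 ^ w.

Definition step (w : nat) (i : instr) (s : state) : state :=
  let: State p r m := s in
  match i with
  | Const d v => State p.+1 (upd r d (v %% 2 ^ w)) m
  | Arith o d x y => State p.+1 (upd r d (eval_arith w o (r x) (r y))) m
  | Read d a => State p.+1 (upd r d (m (r a))) m
  | Write a x => State p.+1 r (upd m (r a) (r x))
  | Jump l => State l r m
  | JumpEq x y l => State (if r x == r y then l else p.+1) r m
  | JumpLt x y l => State (if r x < r y then l else p.+1) r m
  | Halt _ => s
  end.

(* [run w P k s = Some b] iff, started in [s], [P] executes [Halt b] as one of
   its first [k] instructions; every instruction costs one unit of time. *)
Fixpoint run (w : nat) (P : program) (k : nat) (s : state) : option bool :=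
  if k is k'.+1 then
    match onth P (pc s) with
    | None => None
    | Some (Halt b) => Some b
    | Some i => run w P k' (step w i s)
    end
  else None.

(* Input in memory from address 0, its length in register 0; all other
   registers and cells are initially 0. *)
Definition init (input : seq nat) : state :=
  State 0 (upd (fun=> 0) 0 (size input)) (nth 0 input).

(* Preorder listing of the tree: a leaf is 0 followed by its letter, an inner
   node is the code of its operator, its number of children, its children. *)
Fixpoint encode (e : regexp) : seq nat :=
  match e with
  | Letter c => [:: 0; c]
  | Concat e1 es =>
      [:: op_code OConcat, (size es).+1 & encode e1 ++ flatten (map encode es)]
  | Union e1 es =>
      [:: op_code OUnion, (size es).+1 & encode e1 ++ flatten (map encode es)]
  | Plus e1 => [:: op_code OPlus, 1 & encode e1]
  | Star e1 => [:: op_code OStar, 1 & encode e1]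
  end.

(* Main.v *)
Require Import Defs.
From mathcomp Require Import all_boot.
From mathcomp Require Import zify.

(* Every word of L(A) is a power of one letter, so L(A) is described by the set
   of letters occurring in A, the set of those occurring under an iteration,
   and whether some branch is starred; direct addressing into the initially
   zero memory stores the two sets as tables.  If the root of B is not a
   concatenation, then L(A) meets L(B) outside the empty word iff one child of
   the root already accepts a suitable power, which the tables decide child by
   child.  If B is a concatenation, a letter c has a power in L(B) iff every
   unstarred factor contains c and some factor does; one counter per letter
   records how many unstarred factors in a row have contained it, and from the
   second such factor on only the letters iterated in A may survive. *)

Set Implicit Arguments.
Unset Strict Implicit.
Unset Printing Implicit Defensive.

(* The comments are addresses.  Registers: 0 input length, base of the tables;
   1 input pointer; 2 children left; 3, 13, 14 the constants 1, 0, 4; 4 code of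
   the current child; 5 its current letter; 6 address or scratch; 7 letters
   left in it; 8 some branch of A is starred; 9 B accepts the empty word, or,
   for a concatenation, some starred letter occurs in A; 10 flag of the current
   child; 11 its first letter, or the number of unstarred factors already read;
   12 whether that number is positive.
   Cells 4c, 4c+1, 4c+2 of the tables: c occurs in A; c is iterated in A; the
   counter of c.
   Addresses 4-21 fill the tables, 29-70 treat B with root union, plus or star,
   71-117 treat B with root concatenation. *)
Definition prog : program := [::
  (* 0 *)
  Const 3 1; Const 14 4; Read 2 3; Const 1 2;
  (* 4 *)
  JumpEq 2 13 22; Read 4 1; Arith Add 1 1 3; JumpEq 4 13 10;
  Arith Add 1 1 3; Arith Add 1 1 3;
  (* 10 *)
  Read 5 1; Arith Add 1 1 3; Arith Mul 6 5 14; Arith Add 6 6 0; Write 6 3;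
  Arith Defs.Sub 2 2 3; JumpEq 4 13 4; Arith Add 6 6 3; Write 6 3;
  JumpLt 4 14 4; Const 8 1; Jump 4;
  (* 22 *)
  Read 4 1; Arith Add 1 1 3; Read 2 1; Arith Add 1 1 3;
  JumpEq 4 3 71; JumpLt 4 14 29; Const 9 1;
  (* 29 *)
  JumpEq 2 13 67; Arith Defs.Sub 2 2 3; Read 4 1; Const 7 1; JumpEq 4 13 39;
  Arith Add 1 1 3; Read 7 1; Arith Add 1 1 3; JumpLt 4 14 39; Const 9 1;
  (* 39 *)
  JumpEq 4 3 50;
  (* 40 *)
  JumpEq 7 13 29; Arith Add 1 1 3; Read 5 1; Arith Add 1 1 3; Arith Defs.Sub 7 7 3;
  Arith Mul 6 5 14; Arith Add 6 6 0; Read 6 6; JumpEq 6 13 40; Halt true;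
  (* 50 *)
  Arith Add 6 1 3; Read 11 6; Arith Mul 6 11 14; Arith Add 6 6 0;
  JumpEq 7 3 56; Arith Add 6 6 3; Read 10 6;
  (* 57 *)
  JumpEq 7 13 65; Arith Add 1 1 3; Read 5 1; Arith Add 1 1 3; Arith Defs.Sub 7 7 3;
  JumpEq 5 11 57; Const 10 0; Jump 57;
  (* 65 *)
  JumpEq 10 13 29; Halt true;
  (* 67 *)
  JumpEq 8 13 70; JumpEq 9 13 70; Halt true; Halt false;
  (* 71 *)
  JumpEq 2 13 113; Arith Defs.Sub 2 2 3; Read 4 1; Const 7 1; JumpEq 4 13 89;
  Arith Add 1 1 3; Read 7 1; Arith Add 1 1 3; JumpLt 4 14 89;
  (* 80 *)
  Arith Add 1 1 3; Read 5 1; Arith Add 1 1 3; Arith Mul 6 5 14;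
  Arith Add 6 6 0; Read 6 6; JumpEq 6 13 71; Const 9 1; Jump 71;
  (* 89 *)
  Const 10 0;
  (* 90 *)
  JumpEq 7 13 109; Arith Add 1 1 3; Read 5 1; Arith Add 1 1 3; Arith Defs.Sub 7 7 3;
  Arith Mul 6 5 14; Arith Add 6 6 0; Arith Add 5 6 12; Read 5 5;
  JumpEq 5 13 90; Arith Add 6 6 3; Arith Add 6 6 3; Read 5 6;
  JumpEq 5 11 105; Jump 90;
  (* 105 *)
  Arith Add 5 5 3; Write 6 5; Const 10 1; Jump 90;
  (* 109 *)
  JumpEq 10 13 117; Const 12 1; Arith Add 11 11 3; Jump 71;
  (* 113 *)
  JumpEq 11 13 115; Halt true; JumpEq 8 3 114; JumpEq 9 3 114;
  (* 117 *)
  Halt false ].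

(** * Symbolic execution: one rule per instruction form *)

Section Exec.
Variable w : nat.

(* [rs] lists the registers from register 0 on. *)
Definition outputs (K p : nat) (rs : seq nat) (m : nat -> nat) (b : bool) :=
  forall r, r =1 nth 0 rs -> run w prog K (State p r m) = Some b.

Lemma run_mono K K' P s b :
  K <= K' -> run w P K s = Some b -> run w P K' s = Some b.
Proof.
elim: K K' s => // K IH [|K'] s //= le_KK'.
by case: onth => // -[] //= *; exact: IH.
Qed.

Lemma outputs_mono K K' p rs m b : K <= K' -> outputs K p rs m b -> outputs K' p rs m b.
Proof. by move=> le_KK' H r /H; exact: run_mono. Qed.

Lemma upd_set_nth (r : nat -> nat) rs d v :
  r =1 nth 0 rs -> upd r d v =1 nth 0 (set_nth 0 rs d v).
Proof. by move=> Er j; rewrite nth_set_nth /upd /= Er. Qed.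

Lemma outputs_halt K p rs m b : onth prog p = Some (Halt b) -> outputs K.+1 p rs m b.
Proof. by move=> Hp r _; rewrite /= Hp. Qed.

Lemma outputs_const d v K p rs m b : onth prog p = Some (Const d v) -> v < 2 ^ w ->
  outputs K p.+1 (set_nth 0 rs d v) m b -> outputs K.+1 p rs m b.
Proof.
by move=> Hp lt_v H r Er; rewrite /= Hp modn_small //; apply/H/upd_set_nth.
Qed.

Lemma outputs_read d a K p rs m b : onth prog p = Some (Read d a) ->
  outputs K p.+1 (set_nth 0 rs d (m (nth 0 rs a))) m b -> outputs K.+1 p rs m b.
Proof. by move=> Hp H r Er; rewrite /= Hp Er; apply/H/upd_set_nth. Qed.

Lemma outputs_write a x K p rs m b : onth prog p = Some (Write a x) ->
  outputs K p.+1 rs (upd m (nth 0 rs a) (nth 0 rs x)) b -> outputs K.+1 p rs m b.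
Proof. by move=> Hp H r Er; rewrite /= Hp !Er; apply: H. Qed.

Lemma outputs_arith v o d x y K p rs m b : onth prog p = Some (Arith o d x y) ->
  eval_arith w o (nth 0 rs x) (nth 0 rs y) = v ->
  outputs K p.+1 (set_nth 0 rs d v) m b -> outputs K.+1 p rs m b.
Proof. by move=> Hp Ev H r Er; rewrite /= Hp !Er Ev; apply/H/upd_set_nth. Qed.

Lemma eval_add x y : x + y < 2 ^ w -> eval_arith w Add x y = x + y.
Proof. exact: modn_small. Qed.

Lemma eval_incr x : x.+1 < 2 ^ w -> eval_arith w Add x 1 = x.+1.
Proof. by move=> lt_x; rewrite /eval_arith addn1 modn_small. Qed.

Lemma eval_mul x y : x * y < 2 ^ w -> eval_arith w Mul x y = x * y.
Proof. exact: modn_small. Qed.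

Lemma eval_decr x : x < 2 ^ w -> eval_arith w Defs.Sub x.+1 1 = x.
Proof. by move=> lt_x; rewrite /eval_arith addSn subn1 modnDr modn_small. Qed.

Lemma outputs_jump l K p rs m b : onth prog p = Some (Jump l) ->
  outputs K l rs m b -> outputs K.+1 p rs m b.
Proof. by move=> Hp H r Er; rewrite /= Hp; apply: H. Qed.

Lemma outputs_jeqT x y l K p rs m b : onth prog p = Some (JumpEq x y l) ->
  nth 0 rs x = nth 0 rs y -> outputs K l rs m b -> outputs K.+1 p rs m b.
Proof. by move=> Hp Exy H r Er; rewrite /= Hp !Er Exy eqxx; apply: H. Qed.

Lemma outputs_jeqF x y l K p rs m b : onth prog p = Some (JumpEq x y l) ->
  nth 0 rs x <> nth 0 rs y -> outputs K p.+1 rs m b -> outputs K.+1 p rs m b.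
Proof.
by move=> Hp /eqP/negPf Exy H r Er; rewrite /= Hp !Er Exy; apply: H.
Qed.

Lemma outputs_jltT x y l K p rs m b : onth prog p = Some (JumpLt x y l) ->
  nth 0 rs x < nth 0 rs y -> outputs K l rs m b -> outputs K.+1 p rs m b.
Proof. by move=> Hp Exy H r Er; rewrite /= Hp !Er Exy; apply: H. Qed.

Lemma outputs_jltF x y l K p rs m b : onth prog p = Some (JumpLt x y l) ->
  nth 0 rs y <= nth 0 rs x -> outputs K p.+1 rs m b -> outputs K.+1 p rs m b.
Proof.
by move=> Hp Exy H r Er; rewrite /= Hp !Er ltnNge Exy; apply: H.
Qed.

End Exec.

(** * Memory: stored sequences and letter tables *)

Fixpoint stored (m : nat -> nat) (p : nat) (s : seq nat) : Prop :=
  if s is x :: s' then m p = x /\ stored m p.+1 s' else True.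

Lemma stored_cat m p s1 s2 :
  stored m p (s1 ++ s2) <-> stored m p s1 /\ stored m (p + size s1) s2.
Proof.
elim: s1 p => [|x s1 IH] p /=; first by rewrite addn0; tauto.
by rewrite IH addSnnS; tauto.
Qed.

Lemma stored_upd m p s a v :
  p + size s <= a -> stored m p s -> stored (upd m a v) p s.
Proof.
elim: s p => //= x s IH p le_a [mp ms]; split; last by apply: IH => //; lia.
by rewrite /upd; case: eqP => //; lia.
Qed.

Lemma stored_nth s : stored (nth 0 s) 0 s.
Proof.
suff H t p : (forall i, nth 0 s (p + i) = nth 0 t i) -> stored (nth 0 s) p t.
  exact: H.
elim: t p => //= x t IH p Ht; split; first by rewrite -[p]addn0 Ht.
by apply: IH => i; rewrite addSnnS Ht.
Qed.

(** The fields of a letter lie within a stride of four cells, so entries of different letters never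
    collide. Quantifying over all [c] makes the zero memory beyond the input a set of empty
    tables. *)
Definition tables (base : nat) (T1 T2 : nat -> bool) (cnt : nat -> nat)
    (m : nat -> nat) : Prop :=
  forall c, [/\ m (c * 4 + base) = T1 c, m (c * 4 + base).+1 = T2 c
              & m (c * 4 + base).+2 = cnt c].

Lemma tables_upd1 base T1 T2 cnt m c : tables base T1 T2 cnt m ->
  tables base (fun x => (x == c) || T1 x) T2 cnt (upd m (c * 4 + base) 1).
Proof.
move=> H x; have [H1 H2 H3] := H x; rewrite /upd.
split; rewrite ?(H1, H2, H3); case: eqP => e1 //; try (exfalso; lia);
  by case: eqP => //; lia.
Qed.

Lemma tables_upd2 base T1 T2 cnt m c : tables base T1 T2 cnt m ->
  tables base T1 (fun x => (x == c) || T2 x) cnt (upd m (c * 4 + base).+1 1).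
Proof.
move=> H x; have [H1 H2 H3] := H x; rewrite /upd.
split; rewrite ?(H1, H2, H3); case: eqP => e1 //; try (exfalso; lia);
  by case: eqP => //; lia.
Qed.

Lemma tables_upd3 base T1 T2 cnt m c v : tables base T1 T2 cnt m ->
  tables base T1 T2 (fun x => if x == c then v else cnt x)
    (upd m (c * 4 + base).+2 v).
Proof.
move=> H x; have [H1 H2 H3] := H x; rewrite /upd.
split; rewrite ?(H1, H2, H3); case: eqP => e1 //; try (exfalso; lia);
  by case: eqP => //; lia.
Qed.

(** * Shallow trees: their letters and encodings *)

Definition shallow (d : regexp) : bool := is_leaf d || all is_leaf (children d).
Definition letter_of (e : regexp) : nat := if e is Letter c then c else 0.
Definition letters (d : regexp) : seq nat :=
  if d is Letter c then [:: c] else map letter_of (children d).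
(** The first cell of the encoding, hence [0] for a leaf. *)
Definition code (d : regexp) : nat := if label d is Some o then op_code o else 0.
Definition leaf_codes (ls : seq nat) : seq nat := flatten [seq [:: 0; c] | c <- ls].

Lemma is_leafP e : reflect (exists c, e = Letter c) (is_leaf e).
Proof. by case: e => *; constructor; try (by eexists); case. Qed.

Lemma encode_leaves es :
  all is_leaf es -> flatten (map encode es) = leaf_codes (map letter_of es).
Proof. by elim: es => //= e es IH /andP [/is_leafP [c ->] /IH ->]. Qed.

Lemma encode_node e : ~~ is_leaf e ->
  encode e = [:: code e, size (children e) & flatten (map encode (children e))].
Proof. by case: e => //= *; rewrite ?cats0. Qed.

Lemma encode_shallow d : shallow d ->
  encode d = (if is_leaf d then [::] else [:: code d; size (letters d)])
             ++ leaf_codes (letters d).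
Proof.
rewrite /shallow; case: (boolP (is_leaf d)) => [/is_leafP [c ->] //|nd /=] H.
rewrite encode_node // (encode_leaves H) /=.
by case: d nd H => //= *; rewrite size_map.
Qed.

Lemma code0 d : (code d == 0) = is_leaf d.
Proof. by case: d. Qed.

Lemma nleaves_shallow d : shallow d -> nleaves d = size (letters d).
Proof.
have H es : all is_leaf es -> sumn (map nleaves es) = size es.
  by elim: es => //= e es IH /andP [/is_leafP [c ->] /IH ->].
by case: d => //= [e es|e es|e|e] /andP [/is_leafP [c ->] //= /H];
  rewrite size_map => ->.
Qed.

Lemma letters_gt0 d : shallow d -> 0 < size (letters d).
Proof. by case: d. Qed.

Lemma size_leaf_codes ls : size (leaf_codes ls) = 2 * size ls.
Proof. by elim: ls => //= c ls; rewrite /leaf_codes => ->; lia. Qed.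

(** Every encoding is nonempty; this keeps the numbers of children below the input length, hence
    within a machine word. *)
Lemma size_flatten_encode ds : size ds <= size (flatten (map encode ds)).
Proof. by elim: ds => //= d ds IH; rewrite size_cat; case: d => *; rewrite /=; lia. Qed.

Lemma over_letters sigma d : shallow d -> over_alphabet sigma d ->
  all (gtn sigma) (letters d).
Proof.
have H es : all is_leaf es -> all (over_alphabet sigma) es ->
    all (gtn sigma) (map letter_of es).
  elim: es => //= e es IH /andP [/is_leafP [x ->] He] /andP [/= -> Hes].
  exact: IH.
rewrite /shallow; case: d => //= [c|e es|e es|e|e]; rewrite ?andbT //.
- exact: (H (e :: es)).
- exact: (H (e :: es)).
- by case/is_leafP => c ->.
- by case/is_leafP => c ->.
Qed.

Lemma tables_ext base T1 T1' T2 T2' cnt cnt' m : T1 =1 T1' -> T2 =1 T2' ->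
  cnt =1 cnt' -> tables base T1 T2 cnt m -> tables base T1' T2' cnt' m.
Proof. by move=> E1 E2 E3 H c; rewrite -E1 -E2 -E3; exact: H. Qed.

(* [lia] is very slow on boolean equations. *)
Ltac lian := repeat match goal with
  | H : @eq bool _ _ |- _ => clear H
  | H : is_true ?x |- _ => lazymatch x with leq _ _ => fail | _ => clear H end
  end; lia.

Ltac rd := eapply outputs_read; [reflexivity|]; rewrite /=.
Ltac wr := eapply outputs_write; [reflexivity|]; rewrite /=.
Ltac cst := eapply outputs_const; [reflexivity| |]; rewrite /=.
Ltac incr := eapply outputs_arith; [reflexivity|rewrite /=; apply: eval_incr|]; rewrite /=.
Ltac decr := eapply outputs_arith; [reflexivity|rewrite /=; apply: eval_decr|]; rewrite /=.
Ltac add := eapply outputs_arith; [reflexivity|rewrite /=; apply: eval_add|]; rewrite /=.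
Ltac mul := eapply outputs_arith; [reflexivity|rewrite /=; apply: eval_mul|]; rewrite /=.
Ltac jmp := eapply outputs_jump; [reflexivity|].
Ltac jeqT := eapply outputs_jeqT; [reflexivity| |]; rewrite /=.
Ltac jeqF := eapply outputs_jeqF; [reflexivity| |]; rewrite /=.
Ltac jltT := eapply outputs_jltT; [reflexivity| |]; rewrite /=.
Ltac jltF := eapply outputs_jltF; [reflexivity| |]; rewrite /=.

(** * Correctness and running time of the loops *)

Section Loops.
Variables (w base sigma : nat).
(** For [c < sigma] and [j < 4] the address [c * 4 + base + j] is below [2 ^ w], so no address
    computation wraps around. *)
Hypothesis Hw : base + sigma * 4 <= 2 ^ w.

(** Codes 0, 3 and 4 are leaf, plus and star: the branches that [A] may have. *)
Definition iterated_letter d := shallow d && ((code d == 0) || (2 < code d)).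

Lemma iterated_letterP d : iterated_letter d -> (exists c, d = Letter c) \/
  exists c (s : bool), d = if s then Star (Letter c) else Plus (Letter c).
Proof.
case: d => [c|e es|e es|e|e] //=; first by left; exists c.
- by case/andP.
- by case/andP.
- by case: e => // c _; right; exists c, false.
- by case: e => // c _; right; exists c, true.
Qed.

(** The loop lemmas are in continuation style: a premise covers the [K] steps after the exit of the
    loop. Tables and flag [eA] start arbitrary because they already hold the branches read
    before. *)
Lemma outputs_table_loop As rest K p m T1 T2 cnt (eA : bool) r4 r5 r6 r7 r9 r10 r11 r12 b :
  all iterated_letter As -> all (fun d => all (gtn sigma) (letters d)) As ->
  stored m p (flatten (map encode As) ++ rest) ->
  p + size (flatten (map encode As) ++ rest) <= base ->
  tables base T1 T2 cnt m -> 4 < base ->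
  (forall m' r4 r5 r6, let p' := p + size (flatten (map encode As)) in
   stored m' p' rest ->
   tables base (fun c => T1 c || has (fun d => c \in letters d) As)
     (fun c => T2 c || has (fun d => ~~ is_leaf d && (c \in letters d)) As)
     cnt m' ->
   outputs w K 22 [:: base; p'; 0; 1; r4; r5; r6; r7;
      (eA || has (fun d => code d == 4) As : nat); r9; r10; r11; r12; 0; 4]
      m' b) ->
  outputs w (20 * size As + 1 + K) 4
    [:: base; p; size As; 1; r4; r5; r6; r7; (eA : nat);
       r9; r10; r11; r12; 0; 4] m b.
Proof.
move=> + + + + + b4.
elim: As p m T1 T2 eA r4 r5 r6 => [|d As IH] p m T1 T2 eA r4 r5 r6 /=.
  move=> _ _ Hs _ HT H; rewrite muln0 add0n add1n; jeqT => //.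
  move: (H m r4 r5 r6); rewrite addn0 orbF; apply => //.
  by apply: tables_ext HT => // c; rewrite orbF.
case/andP => /iterated_letterP Hd HAs /andP [Hlt HltAs].
rewrite -catA size_cat => /stored_cat [Hsd Hs] Hp HT H.
have := size_flatten_encode As; have := size_cat (flatten (map encode As)) rest => Esz leA.
(* One branch needs at most 19 units, a starred one following the longest path. *)
apply: (@outputs_mono _ (20 * size As + 1 + K).+4.+4.+4.+4.+3); first by lia.
case: Hd => [[c Ed]|[c [s Ed]]].
  have Hc: c < sigma by move: Hlt; rewrite Ed /= andbT.
  subst d => /=; move: Hsd Hs Hp; rewrite /= => -[mp [mp1 _]] Hs Hp.
  jeqF => //; rd; rewrite mp; incr; first by lia.
  jeqT => //; rd; rewrite mp1; incr; first by lia.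
  mul; first by lia.
  add; first by lia.
  wr; decr; first by lia.
  jeqT => //.
  apply: (@outputs_mono _ (20 * size As + 1 + K)); first by lia.
  apply: IH => //.
  - have -> : p.+2 = p + 2 by lia.
    by apply: stored_upd => //; lia.
  - by lia.
  - by apply: tables_upd1 HT.
  move=> m' s4 s5 s6 p' Hs' HT'.
  move: (H m' s4 s5 s6) => /=.
  have -> : p + (size (flatten [seq encode i | i <- As])).+2 = p' by rewrite /p' !addnS !addSn.
  apply => //; apply: tables_ext HT' => // x /=.
  by rewrite inE orbCA -orbA.
have Hc: c < sigma by move: Hlt; rewrite Ed; case: (s) => /=; rewrite andbT.
have Ee : encode d = [:: if s then 4 else 3; 1; 0; c] by rewrite Ed; case: (s).
have El : letters d = [:: c] by rewrite Ed; case: (s).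
have Ec : code d = if s then 4 else 3 by rewrite Ed; case: (s).
have El' : is_leaf d = false by rewrite Ed; case: (s).
move: Hsd Hs Hp H; rewrite Ee El Ec El' /= => -[mp [_ [_ [mp3 _]]]] Hs Hp H.
jeqF => //; rd; rewrite mp; incr; first by lia.
jeqF; first by case: (s).
incr; first by lia.
incr; first by lia.
rd; rewrite mp3; incr; first by lia.
mul; first by lia.
add; first by lia.
wr; decr; first by lia.
jeqF; first by case: (s).
incr; first by lia.
wr.
set m2 := upd _ _ _.
have Hs2 : stored m2 p.+4 (flatten (map encode As) ++ rest).
  have -> : p.+4 = p + 4 by lia.
  by do 2 (apply: stored_upd; first by lia).
have HT2 : tables base (fun x => (x == c) || T1 x) (fun x => (x == c) || T2 x) cnt m2.
  exact/tables_upd2/tables_upd1.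
have IH' e s4 s5 s6 : e = (eA || s) ->
  outputs w (20 * size As + 1 + K) 4
    [:: base; p.+4; size As; 1; s4; s5; s6; r7; (e : nat);
        r9; r10; r11; r12; 0; 4] m2 b.
  move=> Ee'; apply: (IH _ _ _ _ _ _ _ _ HAs HltAs Hs2 _ HT2); first by lia.
  move=> m' t4 t5 t6 p' Hs' HT'.
  move: (H m' t4 t5 t6) => /=.
  have -> : p + (size (flatten [seq encode i | i <- As])).+4 = p' by rewrite /p' !addnS !addSn.
  have -> : (if s then 4 else 3) == 4 = s by case: (s).
  rewrite Ee' -orbA; apply => //; apply: tables_ext HT' => // x /=.
  - by rewrite inE orbCA -orbA.
  - by rewrite inE orbCA -orbA.
case: s Ed Ee Ec mp H IH' => Ed Ee Ec mp H IH'.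
  jltF => //; cst; first by lia.
  jmp; apply: (@outputs_mono _ (20 * size As + 1 + K)); first by lia.
  by apply: (IH' true); rewrite orbT.
jltT => //; apply: (@outputs_mono _ (20 * size As + 1 + K)); first by lia.
by apply: IH'; rewrite orbF.
Qed.

(** A hit halts the run with [true], which is right as soon as a hit forces the final answer [b];
    without a hit the run goes on to the next child. *)
Lemma outputs_any_loop ls rest K p m T1 T2 cnt n r4 r5 r6 r8 r9 r10 r11 r12 (b : bool) :
  all (gtn sigma) ls -> stored m p (leaf_codes ls ++ rest) ->
  p + 2 * size ls <= base -> 4 < base -> tables base T1 T2 cnt m ->
  (has T1 ls -> b) ->
  (~~ has T1 ls -> forall r5 r6, outputs w K 29
     [:: base; p + 2 * size ls; n; 1; r4; r5; r6; 0;
         r8; r9; r10; r11; r12; 0; 4] m b) ->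
  outputs w (10 * size ls + 1 + K) 40
    [:: base; p; n; 1; r4; r5; r6; size ls; r8; r9; r10; r11; r12; 0; 4] m b.
Proof.
move=> + + + b4 HT.
elim: ls p r5 r6 => [|c ls IH] p r5 r6 /=.
  move=> _ _ _ _ H; rewrite muln0 add0n add1n; jeqT => //.
  by move: (H isT r5 r6); rewrite muln0 addn0.
move=> /andP [Hc Hls] [_ [mp1 Hs]] Hp Hb H.
have [Tc _ _] := HT c.
apply: (@outputs_mono _ (10 * size ls + 1 + K).+4.+4.+2); first by lia.
jeqF => //; incr; first by lia.
rd; rewrite mp1; incr; first by lia.
decr; first by lia.
mul; first by lia.
add; first by lia.
rd; rewrite Tc; case: (T1 c) Hb H => /= Hb H.
  by jeqF => //; rewrite Hb //; exact: outputs_halt.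
jeqT => //; apply: (@outputs_mono _ (10 * size ls + 1 + K)); first by lia.
apply: IH => //; first by lia.
move=> nT s5 s6; have -> : p.+2 + 2 * size ls = p + 2 * (size ls).+1 by lia.
exact: H.
Qed.

(** [good] is register 10. A letter other than [f] clears it, but the remaining letters are still
    read, so that the pointer ends on the next child. *)
Lemma outputs_all_loop ls rest K p m n r4 r5 r6 r8 r9 (good : bool) f r12 (b : bool) :
  stored m p (leaf_codes ls ++ rest) -> p + 2 * size ls < 2 ^ w ->
  (good && all (pred1 f) ls -> b) ->
  (~~ (good && all (pred1 f) ls) -> forall r5 r10, outputs w K 29
     [:: base; p + 2 * size ls; n; 1; r4; r5; r6; 0;
         r8; r9; r10; f; r12; 0; 4] m b) ->
  outputs w (10 * size ls + 3 + K) 57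
    [:: base; p; n; 1; r4; r5; r6; size ls; r8; r9; good : nat; f; r12; 0; 4]
    m b.
Proof.
elim: ls p r5 good => [|c ls IH] p r5 good /=.
  move=> _ _ Hb H; rewrite muln0 add0n !addSn add0n; jeqT => //.
  case: good Hb H => /= Hb H.
    by jeqF => //; rewrite Hb //; exact: outputs_halt.
  jeqT => //; apply: (@outputs_mono _ K); first by lia.
  by move: (H isT r5 0); rewrite muln0 addn0.
move=> [_ [mp1 Hs]] Hp Hb H.
apply: (@outputs_mono _ (10 * size ls + 3 + K).+4.+4.+1); first by lia.
have E2 : p.+2 + 2 * size ls = p + 2 * (size ls).+1 by lia.
jeqF => //; incr; first by lia.
rd; rewrite mp1; incr; first by lia.
decr; first by lia.
have [ecf|ncf] := eqVneq c f.
  jeqT => //; apply: (@outputs_mono _ (10 * size ls + 3 + K)); first by lia.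
  by apply: IH => //; rewrite ?E2 //; move: Hb H; rewrite ecf eqxx.
jeqF; first exact/eqP.
cst; first by lia.
jmp; apply: (@outputs_mono _ (10 * size ls + 3 + K)); first by lia.
apply: (IH _ _ false) => //; rewrite ?E2 //.
by move: H; rewrite (negPf ncf) andbF.
Qed.

(* [long]: at least two letters have to be matched. *)
Definition lookup (T1 T2 : nat -> bool) (long : bool) (c : nat) : bool :=
  if long then T2 c else T1 c.

(** Raising the counter of a survivor from [i] to [i.+1] intersects the set of survivors with this
    factor in time linear in the factor, without touching any other letter. *)
Lemma outputs_factor_loop ls rest K p m (T1 T2 : nat -> bool) i n
    r4 r5 r6 r8 r9 (found long : bool) cnt b :
  all (gtn sigma) ls -> stored m p (leaf_codes ls ++ rest) ->
  p + size (leaf_codes ls ++ rest) <= base -> 4 < base ->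
  tables base T1 T2 cnt m -> i.+1 < 2 ^ w ->
  (forall m' r5 r6, stored m' (p + 2 * size ls) rest ->
   tables base T1 T2
     (fun c => if [&& c \in ls, lookup T1 T2 long c & cnt c == i] then i.+1
               else cnt c) m' ->
   outputs w K 109
    [:: base; p + 2 * size ls; n; 1; r4; r5; r6; 0; r8; r9;
        found || has (fun c => lookup T1 T2 long c && (cnt c == i)) ls : nat;
        i; long : nat; 0; 4] m' b) ->
  outputs w (20 * size ls + 1 + K) 90
    [:: base; p; n; 1; r4; r5; r6; size ls; r8; r9; found : nat; i;
        long : nat; 0; 4] m b.
Proof.
move=> + + + b4 + lt_i.
elim: ls p r5 r6 m cnt found => [|c ls IH] p r5 r6 m cnt found /=.
  move=> _ Hs _ HT H; rewrite muln0 add0n add1n; jeqT => //.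
  by move: (H m r5 r6); rewrite muln0 addn0 orbF; apply.
move=> /andP [Hc Hls] [_ [mp1 Hs]] Hp HT H.
have [Tc1 Tc2 Tc3] := HT c.
(* Adding the flag [long] to the address of [c] selects the column [T1] or [T2]. *)
have Tc : m (c * 4 + base + long) = lookup T1 T2 long c.
  by case: (long); rewrite /= ?addn0 ?addn1.
have Esz : size (leaf_codes ls ++ rest) = 2 * size ls + size rest.
  by rewrite size_cat size_leaf_codes.
rewrite -/(leaf_codes ls) in Hs Hp.
have Ep : p.+2 + 2 * size ls = p + 2 * (size ls).+1 by lia.
apply: (@outputs_mono _ (20 * size ls + 1 + K).+4.+4.+4.+4.+3); first by lia.
jeqF => //; incr; first by lia.
rd; rewrite mp1; incr; first by lia.
decr; first by lia.
mul; first by lia.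
add; first by lia.
add; first by lia.
rd; rewrite Tc.
(* Both ways of rejecting [c], an empty table entry or a wrong counter, leave memory and flag
   unchanged and share this continuation. *)
have Hskip (e : bool) s5 s6 :
    e = (lookup T1 T2 long c && (cnt c == i)) -> e = false ->
  outputs w (20 * size ls + 1 + K) 90
    [:: base; p.+2; n; 1; r4; s5; s6; size ls; r8; r9; found : nat; i;
        long : nat; 0; 4] m b.
  move=> Ee e0; apply: IH => //; first by lia.
  move=> m' t5 t6; rewrite Ep => Hs' HT'.
  move: (H m' t5 t6); rewrite -Ee e0; apply=> //.
  apply: tables_ext HT' => // x; rewrite inE.
  by case: (eqVneq x c) => [->|] //=; rewrite -Ee e0 andbF.
case ET: (lookup T1 T2 long c) Hskip => /= Hskip; last first.
  jeqT => //; apply: (@outputs_mono _ (20 * size ls + 1 + K)); first by lia.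
  exact: (Hskip false).
jeqF => //; incr; first by lia.
incr; first by lia.
rd; rewrite Tc3.
have [Ei|Ni] := eqVneq (cnt c) i; last first.
  jeqF; first exact/eqP.
  jmp; apply: (@outputs_mono _ (20 * size ls + 1 + K)); first by lia.
  by apply: (Hskip false) => //; rewrite (negPf Ni).
jeqT => //; rewrite Ei.
incr; first by lia.
wr; cst; first by lia.
jmp; apply: (@outputs_mono _ (20 * size ls + 1 + K)); first by lia.
apply: (IH _ _ _ _ _ true _ _ _ (tables_upd3 _ _ HT)) => //.
- by apply: stored_upd => //; lia.
- by lia.
move=> m' t5 t6; rewrite Ep => Hs' HT'.
move: (H m' t5 t6); rewrite ET Ei eqxx orbT; apply=> //.
(* A second [c] in the same factor finds its counter at [i.+1], which differs from [i], and is
   skipped. *)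
apply: tables_ext HT' => // x; rewrite inE.
case: (eqVneq x c) => [->|] //=; rewrite ET Ei eqxx /=.
by rewrite eqn_leq ltnn !andbF.
Qed.

(** A concatenation accepts only its own word, which must be a power of its first letter. Any other
    child accepts each of its letters as a one-letter word, and so does [A] for every letter
    occurring in it; hence [T1] suffices there. The default of [head] is never reached on shallow
    trees. *)
Definition hit (T1 T2 : nat -> bool) (d : regexp) : bool :=
  if code d == 1 then
    let f := head 0 (letters d) in
    lookup T1 T2 (size (letters d) != 1) f && all (pred1 f) (letters d)
  else has T1 (letters d).

Lemma outputs_union_loop ds p m T1 T2 cnt (eA eB : bool) r4 r5 r6 r7 r10 r11 r12 :
  all shallow ds -> all (fun d => all (gtn sigma) (letters d)) ds ->
  stored m p (flatten (map encode ds)) ->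
  p + size (flatten (map encode ds)) <= base -> 4 < base ->
  tables base T1 T2 cnt m ->
  outputs w (40 * sumn (map nleaves ds) + 5) 29
    [:: base; p; size ds; 1; r4; r5; r6; r7; eA : nat; eB : nat;
        r10; r11; r12; 0; 4] m
    (has (hit T1 T2) ds || eA && (eB || has (fun d => code d == 4) ds)).
Proof.
move=> + + + + b4 HT.
elim: ds p eB r4 r5 r6 r7 r10 r11 => [|d ds IH] p eB r4 r5 r6 r7 r10 r11 /=.
  move=> _ _ _ _; rewrite orbF; jeqT => //.
  case: eA; last by jeqT => //; exact: outputs_halt.
  jeqF => //; case: eB; last by jeqT => //; exact: outputs_halt.
  by jeqF => //; exact: outputs_halt.
move=> /andP [Hd Hds] /andP [Hls Hlds] Hs; rewrite size_cat => Hp.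
have := size_flatten_encode ds; have := letters_gt0 Hd => szd szds.
have Esz := congr1 size (encode_shallow Hd).
rewrite size_cat size_leaf_codes in Esz.
rewrite nleaves_shallow // mulnDr.
move Eb: (_ || _) => b.
(* Leaves and inner nodes meet at address 39; [q] is where the leaf codes start, [p] for a leaf and
   [p.+2] after a header. *)
have Hmain q s5 s6 s10 s11 K :
    q + 2 * size (letters d) = p + size (encode d) ->
    stored m q (leaf_codes (letters d) ++ flatten (map encode ds)) ->
    30 * size (letters d) + 40 * sumn (map nleaves ds) + 5 <= K ->
  outputs w K 39
    [:: base; q; size ds; 1; code d; s5; s6; size (letters d); eA : nat;
        (eB || (code d == 4)) : nat; s10; s11; r12; 0; 4] m b.
  move=> Eq Hq /outputs_mono; apply.
  apply: (@outputs_mono _ (20 * size (letters d) + 10 * size (letters d)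
                        + 40 * sumn (map nleaves ds) + 5)); first by lian.
  have Hnext t4 t5 t6 t7 t10 t11 : ~~ hit T1 T2 d ->
    outputs w (40 * sumn (map nleaves ds) + 5) 29
    [:: base; q + 2 * size (letters d); size ds; 1; t4; t5; t6; t7; eA : nat;
        (eB || (code d == 4)) : nat; t10; t11; r12; 0; 4] m b.
    move=> /negPf nhit; rewrite -Eb nhit /= orbA; apply: IH => //.
      by case/stored_cat: Hq => _; rewrite size_leaf_codes.
    by rewrite Eq; lian.
  apply: (@outputs_mono _ (10 * size (letters d) + 3 +
      (40 * sumn (map nleaves ds) + 5)).+4.+4); first by lian.
  case Ec: (code d == 1); last first.
    jeqF; first by apply/eqP; rewrite Ec.
    apply: (@outputs_mono _ (10 * size (letters d) + 1 +
      (40 * sumn (map nleaves ds) + 5))); first by lian.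
    apply: (outputs_any_loop Hls Hq) => //; first by lian.
      by move=> Hh; rewrite -Eb /hit Ec Hh.
    by move=> nh t5 t6; apply: Hnext; rewrite /hit Ec.
  jeqT; first exact/eqP.
  have [f [ls El]] : exists f ls, letters d = f :: ls.
    by case: (letters d) szd => // f ls; exists f, ls.
  have [_ [mq _]] : stored m q [:: 0, f & leaf_codes ls ++ flatten (map encode ds)].
    by move: Hq; rewrite El.
  have Hf : f < sigma by move: Hls; rewrite El => /andP [].
  have [T1f T2f _] := HT f.
  have Hlookup s s' K' :
      10 * size (letters d) + 3 + (40 * sumn (map nleaves ds) + 5) <= K' ->
      outputs w K' 57
      [:: base; q; size ds; 1; code d; s; s'; size (letters d); eA : nat;
        (eB || (code d == 4)) : nat;
        lookup T1 T2 (size (letters d) != 1) f : nat; f; r12; 0; 4] m b.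
    move=> /outputs_mono; apply.
    have Ehit : hit T1 T2 d =
      lookup T1 T2 (size (letters d) != 1) f && all (pred1 f) (letters d).
      by rewrite /hit Ec El.
    apply: (outputs_all_loop Hq); first by lian.
      by rewrite -Ehit -Eb => ->.
    by rewrite -Ehit => nh *; exact: Hnext.
  incr; first by lian.
  rd; rewrite mq; mul; first by lian.
  add; first by lian.
  have [E1|N1] := eqVneq (size (letters d)) 1.
    jeqT => //; rd; rewrite T1f.
    by move: Hlookup; rewrite E1 eqxx; apply; lian.
  jeqF; first exact/eqP.
  incr; first by lian.
  rd; rewrite T2f.
  by move: Hlookup; rewrite N1; apply; lian.
apply: (@outputs_mono _ (30 * size (letters d) + 40 * sumn (map nleaves ds) + 5).+4.+4.+2).
  by lian.
jeqF => //; decr; first by lian.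
case/stored_cat: (Hs) => Hsd Hsds.
rewrite -code0 in Esz.
move: Hs Hsd Hmain; rewrite (encode_shallow Hd) -code0.
case Ec: (code d == 0) Esz => /= Esz.
  move=> Hs Hsd Hmain.
  have mp : m p = 0.
    by case: (letters d) szd Hsd => // c ls _ [].
  rd; rewrite mp; cst; first by lian.
  jeqT => //.
  have E1 : size (letters d) = 1 by case: (d) Ec.
  move: Hmain; rewrite (eqP Ec) E1 orbF; apply => //.
  - by rewrite size_leaf_codes E1.
  - by lian.
move=> [mp [mp1 Hs]] _ Hmain.
rd; rewrite mp; cst; first by lian.
jeqF; first exact/eqP/negbT.
incr; first by lian.
rd; rewrite mp1; incr; first by lian.
have [Es|Ns] := eqVneq (code d) 4.
  jltF; first by rewrite Es.
  cst; first by lian.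
  move: Hmain; rewrite Es orbT; apply => //; rewrite ?size_leaf_codes; lian.
jltT; first by case: (d) Ns.
by move: Hmain; rewrite (negPf Ns) orbF; apply; rewrite // ?size_leaf_codes; lian.
Qed.

(* [S] holds the letters common to the unstarred factors already read, [long]
   tells whether there were any, and [e] whether the empty word or a letter
   taken from a starred factor is a common word if there are none at all. *)
Fixpoint concat_check (T1 T2 : nat -> bool) (e long : bool) (S : nat -> bool)
    (ds : seq regexp) : bool :=
  if ds is d :: ds' then
    if code d == 4 then concat_check T1 T2 (e || has T1 (letters d)) long S ds'
    else
      let S' c := [&& c \in letters d, lookup T1 T2 long c & S c] in
      has S' (letters d) && concat_check T1 T2 e true S' ds'
  else long || e.

(* A letter survives iff its counter equals [i], the number of unstarred factors
   read so far; hence the counters never have to be reset. *)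
Lemma outputs_concat_loop ds p m T1 T2 S cnt i (eA f0 : bool) r4 r5 r6 r7 r10 :
  all shallow ds -> all (fun d => all (gtn sigma) (letters d)) ds ->
  stored m p (flatten (map encode ds)) ->
  p + size (flatten (map encode ds)) <= base -> 4 < base ->
  tables base T1 T2 cnt m -> i + size ds <= base -> 0 < sigma ->
  (forall c, (cnt c == i) = S c) -> (forall c, cnt c <= i) ->
  outputs w (40 * sumn (map nleaves ds) + 5) 71
    [:: base; p; size ds; 1; r4; r5; r6; r7; eA : nat; f0 : nat;
        r10; i; (0 < i) : nat; 0; 4] m
    (concat_check T1 T2 (eA || f0) (0 < i) S ds).
Proof.
move=> + + + + b4 + + s0.
elim: ds p m S cnt i f0 r4 r5 r6 r7 r10 =>
    [|d ds IH] p m S cnt i f0 r4 r5 r6 r7 r10 /=.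
  move=> _ _ _ _ _ _ _ _; jeqT => //.
  case: i => [|i]; last by jeqF => //; exact: outputs_halt.
  jeqT => //; case: eA; first by jeqT => //; exact: outputs_halt.
  jeqF => //; case: f0; first by jeqT => //; exact: outputs_halt.
  by jeqF => //; exact: outputs_halt.
move=> /andP [Hd Hds] /andP [Hls Hlds] Hs; rewrite size_cat => Hp HT Hi HS Hcnt.
have := size_flatten_encode ds; have := letters_gt0 Hd => szd szds.
have Esz := congr1 size (encode_shallow Hd).
rewrite size_cat size_leaf_codes -code0 in Esz.
rewrite nleaves_shallow // mulnDr.
move Eb: (if _ then _ else _) => b.
case/stored_cat: (Hs) => Hsd Hsds.
have Hmand q s5 s6 s10 K :
    q + 2 * size (letters d) = p + size (encode d) -> code d != 4 ->
    stored m q (leaf_codes (letters d) ++ flatten (map encode ds)) ->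
    20 * size (letters d) + 40 * sumn (map nleaves ds) + 11 <= K ->
  outputs w K 89
    [:: base; q; size ds; 1; code d; s5; s6; size (letters d); eA : nat;
        f0 : nat; s10; i; (0 < i) : nat; 0; 4] m b.
  move=> Eq Nc Hq /outputs_mono; apply.
  apply: (@outputs_mono _ (20 * size (letters d) + 1 +
    (40 * sumn (map nleaves ds) + 5).+4).+1); first by lian.
  cst; first by lian.
  apply: (outputs_factor_loop (found := false) Hls Hq _ b4 HT); first 2 last.
  - move=> m' t5 t6 Hq' HT'; rewrite orFb.
    move: Eb; rewrite (negPf Nc) /= => Eb.
    have Eh : has (fun c => [&& c \in letters d, lookup T1 T2 (0 < i) c & S c])
        (letters d) = has (fun c => lookup T1 T2 (0 < i) c && (cnt c == i)) (letters d).
      by apply: eq_in_has => c c_in; rewrite c_in HS.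
    rewrite Eh in Eb.
    case: (has _ _) Eb => /= Eb; last first.
      by jeqT => //; rewrite -Eb; apply: outputs_halt.
    jeqF => //; cst; first by lian.
    incr; first by lian.
    jmp; rewrite -Eb.
    apply: (IH _ _ _ _ i.+1 _ _ _ _ _ _ Hds Hlds Hq' _ HT') => //=.
    + by rewrite Eq; lian.
    + by lian.
    (* A counter that was not advanced is at most [i], so the counters equal to [i.+1] are exactly
       those of the new survivors. *)
    + move=> c; rewrite -HS; case: ifP => // _.
        by rewrite eqxx.
      by apply/negbTE; rewrite neq_ltn ltnS Hcnt.
    + by move=> c; case: ifP => // _; apply: leqW.
  - by rewrite size_cat size_leaf_codes addnA Eq -addnA.
  - by lian.
apply: (@outputs_mono _
  (20 * size (letters d) + 40 * sumn (map nleaves ds) + 5).+4.+4.+4.+4.+4).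
  by lian.
jeqF => //; decr; first by lian.
move: Hs Hsd Hmand; rewrite (encode_shallow Hd) -code0.
case Ec: (code d == 0) Esz => /= Esz.
  move=> Hs Hsd Hmand.
  have mp : m p = 0.
    by case: (letters d) szd Hsd => // c ls _ [].
  rd; rewrite mp; cst; first by lian.
  jeqT => //.
  have E1 : size (letters d) = 1 by case: (d) Ec.
  move: Hmand; rewrite (eqP Ec) E1; apply => //.
  - by rewrite size_leaf_codes E1.
  - by lian.
move=> [mp [mp1 Hs]] _ Hmand.
rd; rewrite mp; cst; first by lian.
jeqF; first exact/eqP/negbT.
incr; first by lian.
rd; rewrite mp1; incr; first by lian.
have [Es|Ns] := eqVneq (code d) 4; last first.
  jltT; first by case: (d) Ns.
  by apply: Hmand => //; rewrite ?size_leaf_codes; lian.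
jltF; first by rewrite Es.
(* A starred factor restricts nothing; its only letter counts just in case no unstarred factor
   occurs at all. *)
have [c El] : exists c, letters d = [:: c].
  by case: (d) Es => // e _; exists (letter_of e).
have E1 : size (letters d) = 1 by rewrite El.
move: Hs Eb Hls Esz; rewrite El Es /= => -[_ [mp2 _]] Eb /andP [Hc _] Esz.
have [T1c _ _] := HT c.
have Hnext f1 s5 s6 s7 s10 : f1 = f0 || T1 c ->
  outputs w (40 * sumn (map nleaves ds) + 5) 71
    [:: base; p.+4; size ds; 1; code d; s5; s6; s7; eA : nat; f1 : nat;
        s10; i; (0 < i) : nat; 0; 4] m b.
  move=> ->; rewrite -Eb orbF -orbA.
  apply: IH HT _ HS Hcnt => //.
  - by have -> : p.+4 = p + size (encode d) by lian.
  - by lian.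
  - by lian.
incr; first by lian.
rd; rewrite mp2; incr; first by lian.
mul; first by lian.
add; first by lian.
rd; rewrite T1c -[X in [:: _, _, _, _, X & _]]Es.
case: (T1 c) Hnext => Hnext.
  jeqF => //; cst; first by lian.
  jmp; apply: (@outputs_mono _ (40 * sumn (map nleaves ds) + 5)); first by lian.
  by apply: (Hnext true); rewrite orbT.
jeqT => //; apply: (@outputs_mono _ (40 * sumn (map nleaves ds) + 5)); first by lian.
by apply: (Hnext f0); rewrite orbF.
Qed.

End Loops.

(** * Languages of shallow trees and of their unions, concatenations and iterations *)

Definition union_of (ds : seq regexp) : language :=
  foldr (fun e => union_lang (lang e)) empty_lang ds.
Definition cat_of (ds : seq regexp) : language :=
  foldr (fun e => cat_lang (lang e)) eps_lang ds.

Lemma union_of_nth ds x :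
  union_of ds x <-> exists2 i, i < size ds & lang (nth (Letter 0) ds i) x.
Proof.
elim: ds => [|d ds IH] /=; first by split=> // -[].
rewrite /union_lang IH; split=> [[dx|[i lt_i ix]]|[[|i] lt_i ix]].
- by exists 0.
- by exists i.+1.
- by left.
- by right; exists i.
Qed.

Lemma union_of_leaves ds x : all is_leaf ds ->
  union_of ds x <-> exists2 a, a \in map letter_of ds & x = [:: a].
Proof.
elim: ds => [|d ds IH] /=; first by split=> // -[].
case/andP=> /is_leafP [c ->] /IH {}IH; rewrite /union_lang IH /=.
split=> [[->|[a Ha ->]]|[a]].
- by exists c; rewrite ?mem_head.
- by exists a; rewrite // inE Ha orbT.
- by rewrite inE => /orP [/eqP ->|Ha ->]; [left|right; exists a].
Qed.

Lemma cat_of_leaves ds x : all is_leaf ds ->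
  cat_of ds x <-> x = map letter_of ds.
Proof.
elim: ds x => //= d ds IH x /andP [/is_leafP [c ->] Hds].
split=> [[u [v [-> -> /(IH _ Hds) ->]]] //|->].
by exists [:: c], (map letter_of ds); split=> //; apply/IH.
Qed.

Lemma pow_letter c k x : pow_lang (fun y => y = [:: c]) k x <-> x = nseq k c.
Proof.
elim: k x => //= k IH x; split=> [[u [v [-> -> /IH ->]]] //|->].
by exists [:: c], (nseq k c); split=> //; apply/IH.
Qed.

Lemma pow_lang1 (L : language) x : L x -> pow_lang L 1 x.
Proof. by move=> Lx; exists x, [::]; rewrite cats0. Qed.

Lemma pow_lang_nil (L : language) k : 0 < k -> pow_lang L k [::] -> L [::].
Proof. by case: k => // k _ [[|a u] [v []]]. Qed.

Lemma nseq_cat (T : eqType) k (c : T) u v : nseq k c = u ++ v ->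
  [/\ u = nseq (size u) c, v = nseq (size v) c & k = size u + size v].
Proof.
move=> E; have : all (pred1 c) (u ++ v) by rewrite -E all_nseq /= eqxx orbT.
rewrite all_cat => /andP [/all_pred1P Eu /all_pred1P Ev].
by split=> //; rewrite -size_cat -E size_nseq.
Qed.

(** Some block of the factorisation of [nseq n c] is nonempty, and it is again a power of [c]. For
    [n = 1] the bound [n' <= n] gives the letter itself. *)
Lemma pow_lang_nseq (L : language) k n c : 0 < n -> pow_lang L k (nseq n c) ->
  exists2 n', 0 < n' <= n & L (nseq n' c).
Proof.
elim: k n => [|k IH] n n0 /=; first by case: n n0.
case=> u [v [/nseq_cat [Eu Ev En] Lu Lv]].
case: (posnP (size u)) => Hu.
  by move: Lv; rewrite Ev; rewrite Hu add0n in En; rewrite -En; exact: IH.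
by exists (size u); [rewrite Hu En leq_addr|rewrite -Eu].
Qed.

(** Among shallow trees only the stars accept the empty word. *)
Definition nullable (d : regexp) : bool := code d == 4.
Definition single (d : regexp) (c : nat) : bool :=
  (c \in letters d) && ((code d == 1) ==> (size (letters d) == 1)).
(** Stands for accepting some positive power of [c]: a concatenation has a single word, and any
    other shallow tree accepts such a power only if it accepts [c] itself. *)
Definition power (d : regexp) (c : nat) : bool :=
  if code d == 1 then all (pred1 c) (letters d) else c \in letters d.

Lemma lang_shallow d x : shallow d ->
  lang d x <->
  if code d == 1 then x = letters d
  else if code d == 3 then exists2 k, 0 < k & x = nseq k (head 0 (letters d))
  else if code d == 4 then exists k, x = nseq k (head 0 (letters d))
  else exists2 a, a \in letters d & x = [:: a].
Proof.
case: d => [c|e es|e es|e|e] Hd.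
- split=> [->|[a]]; first by exists c; rewrite ?mem_head.
  by rewrite inE => /eqP ->.
- exact: (@cat_of_leaves (e :: es)).
- exact: (@union_of_leaves (e :: es)).
- have [c ->] : exists c, e = Letter c by apply/is_leafP; case/andP: Hd.
  by split=> -[k k0 Hx]; exists k => //; apply/pow_letter.
- have [c ->] : exists c, e = Letter c by apply/is_leafP; case/andP: Hd.
  by split=> -[k Hx]; exists k => //; apply/pow_letter.
Qed.

Lemma letters_unary d : shallow d -> (code d == 3) || (code d == 4) ->
  letters d = [:: head 0 (letters d)].
Proof. by case: d. Qed.

Lemma lang_nullable d : shallow d -> lang d [::] <-> nullable d.
Proof.
move=> Hd; rewrite (lang_shallow _ Hd) /nullable.
case: (boolP (code d == 1)) => [/eqP ->|_].
  by have := letters_gt0 Hd; case: (letters d).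
case: (boolP (code d == 3)) => [/eqP ->|_]; first by split=> // -[[]].
by case: ifP => _; split=> //; [exists 0|case].
Qed.

Lemma lang_single d c : shallow d -> lang d [:: c] <-> single d c.
Proof.
move=> Hd; rewrite (lang_shallow _ Hd) /single.
case: (boolP (code d == 1)) => [_|_] /=.
  split=> [<-|]; first by rewrite mem_head.
  by case: (letters d) => [|a [|b l]] //=; rewrite ?andbF // inE andbT => /eqP ->.
case: (boolP (code d == 3)) => [E3|_] /=.
  rewrite (letters_unary Hd) ?E3 // mem_seq1 andbT.
  split=> [[[|[|k]] // _ [<-]]|/eqP ->]; first exact: eqxx.
  by exists 1.
case: (boolP (code d == 4)) => [E4|_] /=.
  rewrite (letters_unary Hd) ?E4 ?orbT // mem_seq1 andbT.
  split=> [[[|[|k]] // [<-]]|/eqP ->]; first exact: eqxx.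
  by exists 1.
by rewrite andbT; split=> [[a Ha [->]] //|Hc]; exists c.
Qed.

Lemma lang_power d c : shallow d ->
  (exists2 k, 0 < k & lang d (nseq k c)) <-> power d c.
Proof.
move=> Hd; case Ep: (power d c).
  split=> // _; move: Ep; rewrite /power; case: ifP => [E1 /all_pred1P El|N1 Hc].
    exists (size (letters d)); first exact: letters_gt0.
    by rewrite (lang_shallow _ Hd) E1.
  by exists 1 => //; apply/lang_single; rewrite // /single Hc N1.
split=> // -[k k0]; rewrite (lang_shallow _ Hd) -{}Ep /power; case: ifP => [_ <-|_].
  by rewrite all_nseq /= eqxx orbT.
case: ifP => [E3|_].
  rewrite (letters_unary Hd) ?E3 // => -[[//|j] _]; case: k k0 => // k _ [-> _].
  exact: mem_head.
case: ifP => [E4|_].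
  rewrite (letters_unary Hd) ?E4 ?orbT // => -[[|j]]; case: k k0 => // k _ [-> _].
  exact: mem_head.
by case=> a Ha; case: k k0 => // k _ [->].
Qed.

(** * When the language of [A] meets that of [B] *)

Section Tables.
Variable As : seq regexp.
Hypothesis HA : all iterated_letter As.

Definition occurs c := has (fun d => c \in letters d) As.
Definition repeats c := has (fun d => ~~ is_leaf d && (c \in letters d)) As.

Lemma repeats_occurs c : repeats c -> occurs c.
Proof. by apply: sub_has => d /andP []. Qed.

(** Sorts the common words by their origin in [A]. The flag [e] is left free because dropping a
    starred factor from a concatenation may turn it on. *)
Definition meets (e : bool) (L : language) : Prop :=
  [\/ e /\ L [::], exists2 c, occurs c & L [:: c]
    | exists2 c, repeats c & exists2 k, 0 < k & L (nseq k c)].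

Lemma meets_union L :
  (exists x, union_of As x /\ L x) <-> meets (has nullable As) L.
Proof.
have Hnth i : i < size As -> iterated_letter (nth (Letter 0) As i).
  by move=> lt_i; apply: (all_nthP _ HA).
split=> [[x [/union_of_nth [i lt_i]]]|].
  have := Hnth i lt_i => /iterated_letterP [[c Ed]|[c [s Ed]]].
    rewrite Ed => -> Lx; constructor 2; exists c => //.
    by apply/(has_nthP (Letter 0)); exists i => //; rewrite Ed mem_head.
  have rc : repeats c.
    apply/(has_nthP (Letter 0)); exists i => //.
    by rewrite Ed; case: (s); rewrite mem_head.
  rewrite Ed; case: s Ed => Ed [] => [k|k k0] => /pow_letter -> Lx.
    case: k Lx => [|k] Lx.
      constructor 1; split=> //; apply/(has_nthP (Letter 0)); exists i => //.
      by rewrite Ed.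
    by constructor 3; exists c => //; exists k.+1.
  by constructor 3; exists c => //; exists k.
case=> [[/(has_nthP (Letter 0)) [i lt_i Hi] Lx]|[c]|[c]].
- exists [::]; split=> //; apply/union_of_nth; exists i => //.
  by apply/lang_nullable => //; case/andP: (Hnth i lt_i).
- move=> /(has_nthP (Letter 0)) [i lt_i Hi] Lx.
  exists [:: c]; split=> //; apply/union_of_nth; exists i => //.
  case/andP: (Hnth i lt_i) => Hs Hc; apply/lang_single => //.
  by rewrite /single Hi; case: eqP => // E1; move: Hc; rewrite E1.
- move=> /(has_nthP (Letter 0)) [i lt_i Hi] [k k0 Lx].
  exists (nseq k c); split=> //; apply/union_of_nth; exists i => //.
  have := Hnth i lt_i => /iterated_letterP [[a Ed]|[a [s Ed]]]; move: Hi; rewrite Ed //.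
  by case: (s); rewrite mem_seq1 /= => /eqP ->; exists k => //; apply/pow_letter.
Qed.

Lemma hit_meets d : shallow d ->
  hit occurs repeats d <->
  (exists2 c, occurs c & single d c) \/ (exists2 c, repeats c & power d c).
Proof.
move=> Hd; rewrite /hit /single /power; case: ifP => _ /=.
  have := letters_gt0 Hd; case: (letters d) => // f ls _ /=; rewrite eqxx /=.
  (* With one letter both alternatives amount to [occurs f]; with more letters only the power
     alternative is possible. *)
  case: ls => [|g ls] /=.
    rewrite andbT; split=> [Of|[[c Oc]|[c Rc]]].
    - by left; exists f; rewrite // mem_head.
    - by rewrite inE andbT => /eqP <-.
    - by rewrite andbT => /eqP ->; exact: repeats_occurs.
  split=> [/andP [Rf Hall]|[[c _]|[c Rc]]].
  - by right; exists f; rewrite ?eqxx.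
  - by rewrite andbF.
  - by case/andP=> /eqP -> ?; rewrite Rc.
split=> [/hasP [c Hc Oc]|[[c Oc]|[c /repeats_occurs Oc]]].
- by left; exists c; rewrite ?Hc.
- by rewrite andbT => Hc; apply/hasP; exists c.
- by move=> Hc; apply/hasP; exists c.
Qed.

Lemma hit_letters ds c : all shallow ds ->
  (occurs c && has (single^~ c) ds) || (repeats c && has (power^~ c) ds) ->
  has (hit occurs repeats) ds.
Proof.
move=> Hds /orP [] /andP [Tc /(has_nthP (Letter 0)) [i lt_i Hi]];
  apply/(has_nthP (Letter 0)); exists i => //;
  apply/hit_meets; rewrite ?(all_nthP _ Hds) //; [left|right]; by exists c.
Qed.

(** Common frame for the roots union, plus and star: there, one child alone decides whether a
    letter, or some positive power of it, is accepted. *)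
Lemma meets_hit (e1 e2 : bool) L ds : all shallow ds -> (L [::] <-> e2) ->
  (forall c, L [:: c] <-> has (single^~ c) ds) ->
  (forall c, (exists2 k, 0 < k & L (nseq k c)) <-> has (power^~ c) ds) ->
  meets e1 L <-> has (hit occurs repeats) ds || e1 && e2.
Proof.
move=> Hds H0 H1 Hk; split=> [[[-> /H0 ->]|[c Tc /H1 Hc]|[c Tc /Hk Hc]]|].
- by rewrite orbT.
- by rewrite (@hit_letters _ c) // Tc Hc.
- by rewrite (@hit_letters _ c) // Tc Hc orbT.
case/orP => [/(has_nthP (Letter 0)) [i lt_i]|/andP [He /H0 H]]; last by constructor 1.
case/hit_meets; first exact: (all_nthP _ Hds).
- case=> c Tc Hc; constructor 2; exists c => //; apply/H1.
  by apply/(has_nthP (Letter 0)); exists i.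
- case=> c Tc Hc; constructor 3; exists c => //; apply/Hk.
  by apply/(has_nthP (Letter 0)); exists i.
Qed.

Lemma meets_union_of e ds : all shallow ds ->
  meets e (union_of ds) <-> has (hit occurs repeats) ds || e && has nullable ds.
Proof.
move=> Hds.
have Hnth i : i < size ds -> shallow (nth (Letter 0) ds i).
  by move=> lt_i; apply: (all_nthP _ Hds).
have Hhas x (p : pred regexp) : (forall d, shallow d -> lang d x <-> p d) ->
    union_of ds x <-> has p ds.
  move=> Hp; rewrite union_of_nth; split=> [[i lt_i Hi]|/(has_nthP (Letter 0)) [i lt_i Hi]].
    by apply/(has_nthP (Letter 0)); exists i => //; apply/Hp; rewrite ?Hnth.
  by exists i => //; apply/Hp; rewrite ?Hnth.
apply: meets_hit => // [|c|c].
- exact: Hhas lang_nullable.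
- by apply: Hhas => d; exact: lang_single.
split=> [[k k0 /union_of_nth [i lt_i Hi]]|/(has_nthP (Letter 0)) [i lt_i Hi]].
  apply/(has_nthP (Letter 0)); exists i => //.
  by apply/lang_power; [exact: Hnth|exists k].
have [k k0 Hk] := (lang_power c (Hnth i lt_i)).2 Hi.
by exists k => //; apply/union_of_nth; exists i.
Qed.

(** The condition [star || (0 < k)] treats plus and star at once. If an iteration of [d] accepts a
    positive power of [c], one of its blocks is such a power accepted by [d]; conversely a single
    copy of [d] is enough. *)
Lemma meets_iter e (L : language) (star : bool) d : shallow d ->
  (forall x, L x <-> exists2 k, star || (0 < k) & pow_lang (lang d) k x) ->
  meets e L <->
  has (hit occurs repeats) [:: d] || e && (star || has nullable [:: d]).
Proof.
move=> Hd HL; apply: meets_hit; rewrite /= ?Hd //; [|move=> c..]; rewrite orbF.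
- rewrite HL; case: star {HL} => /=; first by split=> // _; exists 0.
  split=> [[k k0 /(pow_lang_nil k0) /lang_nullable -> //]|].
  by move/(lang_nullable Hd)=> H; exists 1 => //; apply: pow_lang1.
- rewrite HL; split=> [[k _ Hk]|/(lang_single _ Hd) H].
    have [//|[|[|j]] // _ H] := @pow_lang_nseq (lang d) k 1 c _ Hk.
    exact/lang_single.
  by exists 1; rewrite ?orbT //; apply: pow_lang1.
- split=> [[n n0 /HL [k _ Hk]]|/(lang_power _ Hd) [n n0 H]].
    have [j /andP [j0 _] H] := pow_lang_nseq n0 Hk.
    by apply/lang_power => //; exists j.
  by exists n => //; apply/HL; exists 1; rewrite ?orbT //; apply: pow_lang1.
Qed.

(** Without concatenations every letter of the child is a word of the child, so its letters and its
    nullability settle which letters have an accepted power. *)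
Definition factor (d : regexp) : bool := shallow d && (code d != 1).

Lemma lang_factor_letter d c : factor d -> c \in letters d -> lang d [:: c].
Proof.
by case/andP=> Hd /negPf Nc Hc; apply/lang_single; rewrite // /single Hc Nc.
Qed.

Lemma lang_factor_nseq d k c : factor d -> 0 < k -> lang d (nseq k c) ->
  c \in letters d.
Proof.
case/andP=> Hd /negPf Nc k0 Hk.
have : power d c by apply/lang_power => //; exists k.
by rewrite /power Nc.
Qed.

Lemma lang_factor_nullable d : factor d -> lang d [::] <-> nullable d.
Proof. by case/andP=> Hd _; exact: lang_nullable. Qed.

Lemma cat_of_nil ds : all factor ds -> cat_of ds [::] <-> all nullable ds.
Proof.
elim: ds => //= d ds IH /andP [Hd Hds]; split=> [[[|a u] [[|b v] []]] //|].
  by move=> _ /(lang_factor_nullable Hd) -> /(IH Hds) ->.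
case/andP=> /(lang_factor_nullable Hd) H1 /(IH Hds) H2.
by exists [::], [::].
Qed.

Definition accepts c d := nullable d || (c \in letters d).

Lemma cat_of_accepts ds k c : all factor ds -> cat_of ds (nseq k c) ->
  all (accepts c) ds.
Proof.
elim: ds k => //= d ds IH k /andP [Hd Hds] [u [v [/nseq_cat [-> -> _] Hu Hv]]].
rewrite (IH _ Hds Hv) andbT /accepts.
case: (posnP (size u)) Hu => [->|u0 Hu].
  by move/(lang_factor_nullable Hd) ->.
by rewrite (lang_factor_nseq Hd u0 Hu) orbT.
Qed.

Lemma accepts_cat_of ds c : all factor ds -> all (accepts c) ds ->
  exists k, cat_of ds (nseq k c).
Proof.
elim: ds => [|d ds IH] /=; first by exists 0.
move=> /andP [Hd Hds] /andP [Hc /(IH Hds) [k Hk]].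
case/orP: Hc => [/(lang_factor_nullable Hd) H|/(lang_factor_letter Hd) H].
  by exists k, [::], (nseq k c).
by exists k.+1, [:: c], (nseq k c).
Qed.

(** With one unstarred factor already read, any further one forces a word of length at least two,
    hence [repeats]. A witness in the survivor set is carried along for the empty list. *)
Lemma concat_check_true e (S : nat -> bool) ds : (exists c, S c) ->
  concat_check occurs repeats e true S ds <->
  exists2 c, S c & all (fun d => nullable d || (c \in letters d) && repeats c) ds.
Proof.
elim: ds e S => [|d ds IH] e S [c0 Sc0] /=; first by split=> // _; exists c0.
rewrite -/(nullable d); case: (nullable d) => /=; first by apply: IH; exists c0.
pose S' c := [&& c \in letters d, repeats c & S c].
split=> [/andP [/hasP [c1 _ Sc1] Hi]|[c Sc /andP [/andP [Hc Rc] Hall]]].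
  have [c /and3P [Hc Rc Sc] Hall] := (IH e S' (ex_intro _ c1 Sc1)).1 Hi.
  by exists c => //; rewrite Hall Hc Rc.
have S'c : S' c by rewrite /S' Hc Rc.
apply/andP; split; first by apply/hasP; exists c.
by apply/(IH e S'); exists c.
Qed.

Lemma meets_cat_of e ds : all factor ds ->
  meets e (cat_of ds) <-> concat_check occurs repeats e false predT ds.
Proof.
elim: ds e => [|d ds IH] e /=.
  move=> _; split=> [[[-> //]|[c _ //]|[c _ [[|k] //]]]|/= He].
  by constructor 1.
case/andP => Hd Hds; rewrite -/(nullable d).
have Hnil := lang_factor_nullable Hd.
case: (boolP (nullable d)) => [Nd|Nd]; rewrite ?Nd.
  have dn := Hnil.2 Nd; rewrite -(IH _ Hds); split.
    case=> [[He /(cat_of_nil (ds := d :: ds))]|[c Tc]|[c Rc [k k0]]].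
    - rewrite /= Hd Hds Nd /= => /(_ isT) H.
      by constructor 1; rewrite He; split=> //; apply/cat_of_nil.
    - case=> [[|a u] [v [/= Ex Hu Hv]]].
        by rewrite -Ex in Hv; constructor 2; exists c.
      case: Ex Hu Hv => <- /esym/nilP; rewrite cat_nilp => /andP [/nilP -> /nilP ->].
      move=> Hu Hv; constructor 1; split=> //; apply/orP; right.
      by apply/hasP; exists c => //; apply: (lang_factor_nseq (k := 1) Hd).
    - case=> u [v [/nseq_cat [Eu Ev Ek] Hu Hv]]; rewrite Eu in Hu; rewrite Ev in Hv.
      (* If nothing is left for the other factors, the word comes from [d] alone and its letter
         witnesses the enlarged flag. *)
      case: (posnP (size v)) => [v0|v0]; last first.
        by constructor 3; exists c => //; exists (size v).
      rewrite v0 in Hv Ek; rewrite addn0 in Ek; rewrite -Ek in Hu.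
      constructor 1; split=> //; apply/orP; right; apply/hasP; exists c.
        exact: lang_factor_nseq Hu.
      exact: repeats_occurs.
  have dcat x : cat_of ds x -> cat_of (d :: ds) x by exists [::], x.
  case=> [[/orP [He|/hasP [c Hc Tc]] H]|[c Tc H]|[c Tc [k k0 H]]].
  - by constructor 1; split=> //; apply: dcat.
  - constructor 2; exists c => //; exists [:: c], [::]; split=> //.
    exact: lang_factor_letter.
  - by constructor 2; exists c => //; apply: dcat.
  - by constructor 3; exists c => //; exists k => //; apply: dcat.
have split1 x : cat_of (d :: ds) x -> exists a u v,
    [/\ x = a :: u ++ v, lang d (a :: u) & cat_of ds v].
  case=> [[|a u] [v [-> Hu Hv]]]; last by exists a, u, v.
  by move/Hnil: Hu; rewrite (negPf Nd).
have all_null c : all nullable ds ->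
    all (fun d => nullable d || (c \in letters d) && repeats c) ds.
  by apply: sub_all => x ->.
pose S c := [&& c \in letters d, occurs c & true].
have Hone c : c \in letters d -> occurs c ->
    all (fun d => nullable d || (c \in letters d) && repeats c) ds ->
    has S (letters d) && concat_check occurs repeats e true S ds.
  move=> Hc Tc Hall; have Sc : S c by rewrite /S Hc Tc.
  have exS : exists c, S c by exists c.
  by apply/andP; split; [apply/hasP|apply/(concat_check_true e ds exS)]; exists c.
split.
  case=> [[_ /split1 [a [u [v [//]]]]]|[c Tc /split1]|[c Rc [k k0 /split1]]].
  - case=> a [u [v [[<-] /esym/nilP]]].
    rewrite cat_nilp => /andP [/nilP -> /nilP ->] Hu /(cat_of_nil Hds) Hv.
    apply: (Hone c) => //; last exact: all_null.
    exact: (lang_factor_nseq (k := 1) Hd).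
  - case=> a [u [v [/(nseq_cat (u := a :: u)) [-> -> _] Hu Hv]]].
    apply: (Hone c) => //; first exact: lang_factor_nseq Hu.
      exact: repeats_occurs.
    by apply: sub_all (cat_of_accepts Hds Hv) => x; rewrite Rc andbT.
case/andP=> /hasP [c0 _ Hc0] Hi.
have [c /and3P [Hc Tc _] Hall] := (concat_check_true e ds (ex_intro S c0 Hc0)).1 Hi.
(* If [c] is iterated in [A], any positive power of it will do; otherwise the remaining factors are
   all nullable and [[:: c]] is a common word. *)
case: (boolP (repeats c)) Hall => Rc Hall.
  have /(accepts_cat_of Hds) [k Hk] : all (accepts c) ds.
    by apply: sub_all Hall => x; rewrite andbT.
  constructor 3; exists c => //; exists k.+1 => //.
  by exists [:: c], (nseq k c); split=> //; apply: lang_factor_letter.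
constructor 2; exists c => //; exists [:: c], [::]; split=> //.
  exact: lang_factor_letter.
apply/(cat_of_nil Hds); apply: sub_all Hall => x.
by rewrite andbF orbF.
Qed.

Definition decision (B : regexp) : bool :=
  let e := has nullable As in
  if code B == 1 then concat_check occurs repeats e false predT (children B)
  else has (hit occurs repeats) (children B)
       || e && (nullable B || has nullable (children B)).

Lemma decisionP B : ~~ is_leaf B -> all shallow (children B) ->
  (code B == 1 -> all factor (children B)) ->
  decision B <-> exists x, union_of As x /\ lang B x.
Proof.
move=> NB Hds Hfac; rewrite meets_union /decision.
case: B NB Hds Hfac => // [e es|e es|e|e] _ Hds Hfac.
- exact: iff_sym (meets_cat_of (ds := e :: es) _ (Hfac isT)).
- exact: iff_sym (meets_union_of (ds := e :: es) _ Hds).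
- by apply: iff_sym; apply: (@meets_iter _ _ false); case/andP: Hds.
- apply: iff_sym; apply: (@meets_iter _ _ true); first by case/andP: Hds.
  by move=> x; split=> [[k Hk]|[k _ Hk]]; exists k.
Qed.

End Tables.

(** * Homogeneous trees, the whole run and the choice of constants *)

Lemma nleaves_node e : ~~ is_leaf e -> nleaves e = sumn (map nleaves (children e)).
Proof. by case: e => //= e; rewrite addn0. Qed.

Lemma over_alphabet_children sigma e : ~~ is_leaf e -> over_alphabet sigma e ->
  all (over_alphabet sigma) (children e).
Proof. by case: e => //= e _ ->. Qed.

Lemma homogeneous_node t1 t2 e : homogeneous t1 t2 e ->
  ~~ is_leaf e /\ all shallow (children e).
Proof.
case/andP=> /eqP He Hc; split; first by rewrite /is_leaf He.
by apply: sub_all Hc => d /orP [Hd|/andP [_ Hd]]; rewrite /shallow Hd ?orbT.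
Qed.

(** Here [t1 <> t2] enters: no child of a root concatenation is itself a concatenation. *)
Lemma homogeneous_factor t1 t2 e : t1 <> t2 -> homogeneous t1 t2 e ->
  code e == 1 -> all factor (children e).
Proof.
move=> ht He; have [_ Hs] := homogeneous_node He; case/andP: He => /eqP He Hc.
rewrite /code He => /eqP E1.
have {E1} Et : t1 = OConcat by case: (t1) E1.
elim: (children e) Hs Hc => //= d ds IH /andP [Hd Hds] /andP [Hdc Hc].
rewrite (IH Hds Hc) andbT /factor Hd /=.
case/orP: Hdc => [/is_leafP [c ->] //|/andP [/eqP Ed _]].
by rewrite /code Ed; apply/eqP => E; apply: ht; rewrite Et; case: (t2) E.
Qed.

Lemma homogeneous_iterated_letter tA e : tA = OPlus \/ tA = OStar ->
  homogeneous OUnion tA e -> all iterated_letter (children e).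
Proof.
move=> htA /andP [_]; apply: sub_all => d.
case/orP=> [/is_leafP [c ->] //|/andP [/eqP Ed Hd]].
by rewrite /iterated_letter /shallow Hd orbT /code Ed; case: htA => ->.
Qed.

(** A child takes two cells per leaf and at most two for its header; having a leaf, it stays within
    four cells per leaf. *)
Lemma size_encode_node e : ~~ is_leaf e -> all shallow (children e) ->
  size (encode e) <= 2 + 4 * nleaves e.
Proof.
move=> Ne Hs; rewrite encode_node // nleaves_node //= !addSn add0n !ltnS.
elim: (children e) Hs => //= d ds IH /andP [Hd /IH {}IH].
rewrite size_cat mulnDr; apply: leq_add => //.
have := letters_gt0 Hd; rewrite nleaves_shallow // encode_shallow // size_cat.
by rewrite size_leaf_codes; case: is_leaf => /=; lia.
Qed.

Lemma size_children e : ~~ is_leaf e -> 0 < size (children e).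
Proof. by case: e. Qed.

Lemma size_le_nleaves ds : all shallow ds -> size ds <= sumn (map nleaves ds).
Proof.
elim: ds => //= d ds IH /andP [Hd /IH {}IH]; rewrite -add1n leq_add //.
by rewrite nleaves_shallow // letters_gt0.
Qed.

Lemma over_children sigma e : ~~ is_leaf e -> all shallow (children e) ->
  over_alphabet sigma e ->
  all (fun d => all (gtn sigma) (letters d)) (children e).
Proof.
move=> Ne Hs /(over_alphabet_children Ne); elim: (children e) Hs => //= d ds IH.
by case/andP=> Hd /IH {}IH /andP [sd /IH ->]; rewrite (over_letters Hd sd).
Qed.

Lemma prog_correct w sigma A B :
  ~~ is_leaf A -> all iterated_letter (children A) ->
  ~~ is_leaf B -> all shallow (children B) ->
  over_alphabet sigma A -> over_alphabet sigma B -> 0 < sigma ->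
  size (encode A ++ encode B) + sigma * 4 <= 2 ^ w ->
  run w prog (60 * (nleaves A + nleaves B)) (init (encode A ++ encode B))
    = Some (decision (children A) B).
Proof.
move=> NA HA NB HB sA sB s0; set input := encode A ++ encode B => Hw.
have HsA : all shallow (children A) by apply: sub_all HA => d /andP [].
have lA := over_children NA HsA sA; have lB := over_children NB HB sB.
have nA := size_children NA; have nB := size_children NB.
have mA := size_le_nleaves HsA; have mB := size_le_nleaves HB.
have fA := size_flatten_encode (children A).
have fB := size_flatten_encode (children B).
have Ein : input = [:: code A, size (children A) &
    flatten (map encode (children A)) ++ encode B].
  by rewrite /input encode_node.
have Esz : 2 + size (flatten (map encode (children A)) ++ encode B) = size input.
  by rewrite Ein.
have Esz' := size_cat (flatten (map encode (children A))) (encode B).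
have EszB : size (encode B) = 2 + size (flatten (map encode (children B))).
  by rewrite encode_node.
have b4 : 4 < size input by lia.
have := stored_nth input; rewrite [X in stored _ _ X]Ein => -[_ [m1 Hin]].
(* The tables start right behind the input, where memory is zero. *)
have HT : tables (size input) (fun=> false) (fun=> false) (fun=> 0) (nth 0 input).
  by move=> c; rewrite !nth_default //; lia.
rewrite !nleaves_node //.
have Er : reg (init input) =1
    nth 0 [:: size input; 0; 0; 0; 0; 0; 0; 0; 0; 0; 0; 0; 0; 0; 0].
  by do 15 case=> //; case.
suff Hdec : outputs w (60 * (sumn (map nleaves (children A)) + sumn (map nleaves (children B))))
   0 [:: size input; 0; 0; 0; 0; 0; 0; 0; 0; 0; 0; 0; 0; 0; 0] (nth 0 input)
   (decision (children A) B).
  exact: Hdec Er.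
(* Four initial instructions, the table loop, at most seven to dispatch on the root of [B], then its
   loop. Both trees have a leaf, so [60] per leaf absorbs the constants. *)
apply: (@outputs_mono _ (20 * size (children A) + 1 +
   (40 * sumn (map nleaves (children B)) + 5).+4.+3).+4); first by lian.
cst; first by lian.
cst; first by lian.
rd; rewrite m1; cst; first by lian.
apply: (outputs_table_loop (eA := false) Hw HA lA Hin _ HT) => //; first by rewrite -Esz.
move=> m' r4 r5 r6 p' Hm' HT'.
move: Hm'; rewrite encode_node // => -[mp [mp1 Hm']].
have Ep : p'.+2 + size (flatten (map encode (children B))) = size input.
  by rewrite /p'; lian.
rd; rewrite mp; incr; first by lian.
rd; rewrite mp1; incr; first by lian.
rewrite /decision.
have [E1|N1] := eqVneq (code B) 1.
  jeqT; first by rewrite E1.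
  apply: (@outputs_mono _ (40 * sumn (map nleaves (children B)) + 5)).
    by lian.
  (* All counters are zero, so at [i = 0] every letter survives. *)
  have := @outputs_concat_loop w (size input) sigma Hw (children B) _ _ _ _ predT _ 0 
     (has nullable (children A)) false _ _ _ _ _ HB lB Hm' _ b4 HT' _ s0.
  by rewrite orbF; apply; rewrite // ?Ep //; lian.
jeqF; first exact/eqP.
have HU e s4 s5 : e = nullable B ->
  outputs w (40 * sumn (map nleaves (children B)) + 5) 29
    [:: size input; p'.+2; size (children B); 1; s4; s5; r6; 0;
       has nullable (children A) : nat; e : nat; 0; 0; 0; 0; 4] m'
    (has (hit (occurs (children A)) (repeats (children A))) (children B)
      || has nullable (children A) && (nullable B || has nullable (children B))).
  by move=> <-; apply: (outputs_union_loop Hw HB lB Hm' _ b4 HT'); rewrite Ep.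
have [E4|N4] := eqVneq (code B) 4.
  jltF; first by rewrite E4.
  cst; first by lian.
  apply: (@outputs_mono _ (40 * sumn (map nleaves (children B)) + 5)); first by lian.
  by apply: (HU true); rewrite /nullable E4.
jltT; first by case: (B) N4.
apply: (@outputs_mono _ (40 * sumn (map nleaves (children B)) + 5)); first by lian.
by apply: (HU false); rewrite /nullable (negPf N4).
Qed.

Theorem theorem7 (t1 t2 tA : op) (k : nat)
    (ht : t1 <> t2) (htA : tA = OPlus \/ tA = OStar) :
  exists (P : program) (C c : nat),
    forall (A B : regexp) (m n sigma w : nat),
      homogeneous OUnion tA A -> nleaves A = m ->
      homogeneous t1 t2 B -> nleaves B = n ->
      over_alphabet sigma A -> over_alphabet sigma B -> sigma <= (m + n) ^ k ->
      (m + n) ^ c <= 2 ^ w ->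
      exists b : bool,
        run w P (C * (m + n)) (init (encode A ++ encode B)) = Some b /\
        (b = true <-> exists x : word, lang A x /\ lang B x).
Proof.
exists prog, 60, (k + 5) => A B m n sigma w homA <- homB <- sA sB Hs Hw.
have [NA HsA] := homogeneous_node homA; have [NB HsB] := homogeneous_node homB.
have HA := homogeneous_iterated_letter htA homA.
exists (decision (children A) B); split; last first.
  have -> : lang A = union_of (children A).
    by case/andP: homA => /eqP; case: (A).
  by apply: decisionP => //; exact: homogeneous_factor homB.
have gA := leq_trans (size_children NA) (size_le_nleaves HsA).
have gB := leq_trans (size_children NB) (size_le_nleaves HsB).
rewrite -!nleaves_node // in gA gB.
have N2 : 2 <= nleaves A + nleaves B by exact: (leq_add gA gB).
apply: (@prog_correct _ sigma) => //.
  (* [A] contains a letter, so the alphabet is nonempty. *)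
  have := over_children NA HsA sA; have := size_children NA.
  case: (children A) HsA => //= d ds /andP [Hd _] _ /andP [+ _].
  by have := letters_gt0 Hd; case: letters => //= c ls _ /andP [+ _]; case: sigma {sA sB Hs}.
have lA := size_encode_node NA HsA; have lB := size_encode_node NB HsB.
apply: leq_trans Hw; rewrite size_cat expnD.
have X0 : 0 < (nleaves A + nleaves B) ^ k by rewrite expn_gt0; lia.
(* With [N >= 2] leaves in all, input and tables end by [4 + 4 * N + 4 * N ^ k]; the factor
   [N ^ 5 >= 16 * N] of [N ^ (k + 5)] covers this. *)
have N5 : 16 * (nleaves A + nleaves B) <= (nleaves A + nleaves B) ^ 5.
  by rewrite [X in _ <= X]expnSr leq_mul // (@leq_exp2r 2 _ 4).
apply: leq_trans (leq_mul (leqnn _) N5).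
by move: X0 Hs; move: (_ ^ k) => X *; nia.
Qed.
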